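(* Let $\rho$ be a unitary representation of the group $G=S_\infty\times S_\infty\times S_\infty$ in a Hilbert space $H$. Then for all $\alpha,\beta,\gamma\in\{0,1,2,\dots\}$ and all $$\mathfrak p\in K[\alpha]\backslash G/K[\beta],\qquad \mathfrak q\in K[\beta]\backslash G/K[\gamma],$$ we have $$\widetilde\rho(\mathfrak p)\,\widetilde\rho(\mathfrak q)=\widetilde\rho(\mathfrak p\circ\mathfrak q).$$ Moreover, $$\widetilde\rho(\mathfrak p^* )=\widetilde\rho(\mathfrak p)^*,\qquad \|\widetilde\rho(\mathfrak p)\|\le 1 .$$
   Context: $S_\infty$ is the group of finitely supported permutations of $\mathbb N=\{1,2,\dots\}$ (a discrete group), $K=\{(h,h,h)\}\subset G$ is the diagonal subgroup, and $K[\alpha]\subset K$ is the subgroup of $(h,h,h)$ with $h$ fixing $1,\dots,\alpha$. Product: let $\theta_j[\beta]\in K[\beta]$ be the diagonal element given by the permutation which exchanges $\beta+i$ and $\beta+j+i$ for $1\le i\le j$ and fixes all other points. For $\mathfrak p\in K[\alpha]\backslash G/K[\beta]$, $\mathfrak q\in K[\beta]\backslash G/K[\gamma]$ choose $p\in\mathfrak p$, $q\in\mathfrak q$; the sequence $K[\alpha]\,p\,\theta_j[\beta]\,q\,K[\gamma]$ is eventually constant in $j$, with limit independent of the choice of $p,q$; this limit is $\mathfrak p\circ\mathfrak q\in K[\alpha]\backslash G/K[\gamma]$. Involution: $\mathfrak p\mapsto\mathfrak p^*$, $K[\alpha]\backslash G/K[\beta]\to K[\beta]\backslash G/K[\alpha]$,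 is induced by $p\mapsto p^{-1}$. Operators: $H[\alpha]$ is the subspace of $K[\alpha]$-fixed vectors in $H$, $P[\alpha]$ is the orthogonal projection onto $H[\alpha]$, and for $\mathfrak p\in K[\alpha]\backslash G/K[\beta]$ the operator $\widetilde\rho(\mathfrak p):H[\beta]\to H[\alpha]$ is $\widetilde\rho(\mathfrak p)=P[\alpha]\,\rho(p)\big|_{H[\beta]}$ for any $p\in\mathfrak p$ (it does not depend on the choice of $p$). *)

(* Defs.v *)
From HB Require Import structures.
From mathcomp Require Import all_boot all_order all_algebra.
From mathcomp Require Import zify.
From mathcomp Require Import all_classical all_reals all_analysis.
From mathcomp Require Import complex.

Set Implicit Arguments.
Unset Strict Implicit.
Unset Printing Implicit Defensive.

Import Order.TTheory GRing.Theory Num.Theory.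
Import numFieldNormedType.Exports.

Local Open Scope classical_set_scope.
Local Open Scope ring_scope.

(* The infinite symmetric group. Points are 0-based: the point k >= 1 of the
   set {1, 2, ...} is the natural number k.-1. *)

Definition finitary_perm : {pred nat -> nat} :=
  fun f => `[< bijective f /\ finite_set [set n | f n != n] >].

Record Sinfty := MkSinfty {
  sinfty_fun :> nat -> nat;
  sinftyP : sinfty_fun \in finitary_perm }.

HB.instance Definition _ := [isSub for sinfty_fun].
HB.instance Definition _ := [Choice of Sinfty by <:].

Lemma sinfty_eqP (f g : Sinfty) : f =1 g -> f = g.
Proof. by move=> fg; apply/val_inj/funext. Qed.

Lemma sinfty_bij (f : Sinfty) : bijective f.
Proof. by have /asboolP[] := sinftyP f. Qed.

Lemma sinfty_finite (f : Sinfty) : finite_set [set n | f n != n].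
Proof. by have /asboolP[] := sinftyP f. Qed.

Lemma finitary_permP (f g : nat -> nat) N :
  cancel f g -> cancel g f -> (forall n, (N <= n)%N -> f n = n) ->
  f \in finitary_perm.
Proof.
move=> fK gK fN; apply/asboolP; split; first by exists g.
apply: (sub_finite_set _ (finite_II N)) => n /= fn.
by rewrite ltnNge; apply: contra fn => /fN ->.
Qed.

Lemma sinfty_bound (f : Sinfty) :
  exists N, forall n, (N <= n)%N -> f n = n.
Proof.
have /finite_seqP[s sE] := sinfty_finite f.
exists (\max_(i <- s) i.+1)%N => n nN; apply/eqP/negPn/negP => fn.
have ns : n \in s by have : [set` s] n by rewrite -sE.
have := leq_trans (@leq_bigmax_seq _ s xpredT (fun i => i.+1)%N n ns isT) nN.
by rewrite ltnn.
Qed.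

Lemma sinfty_one_subproof : id \in finitary_perm.
Proof. exact: (@finitary_permP id id 0). Qed.

Lemma sinfty_mul_subproof (f g : Sinfty) : (f \o g) \in finitary_perm.
Proof.
have [N fN] := sinfty_bound f; have [M gM] := sinfty_bound g.
have [f' fK f'K] := sinfty_bij f; have [g' gK g'K] := sinfty_bij g.
apply: (@finitary_permP _ (g' \o f') (maxn N M)).
- exact: can_comp.
- exact: can_comp.
- by move=> n; rewrite geq_max => /andP[nN nM] /=; rewrite gM// fN.
Qed.

Definition sinfty_invf (f : nat -> nat) : nat -> nat :=
  fun n => xget 0%N [set m | f m = n].

Lemma sinfty_invfK (f : Sinfty) : cancel f (sinfty_invf f).
Proof.
move=> n; apply: xget_unique => //= m; exact: (bij_inj (sinfty_bij f)).
Qed.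

Lemma sinfty_invfVK (f : Sinfty) : cancel (sinfty_invf f) f.
Proof.
have [g fK gK] := sinfty_bij f.
by move=> n; rewrite -{1}(gK n) sinfty_invfK gK.
Qed.

Lemma sinfty_inv_subproof (f : Sinfty) : sinfty_invf f \in finitary_perm.
Proof.
have [N fN] := sinfty_bound f.
apply: (@finitary_permP _ f N (@sinfty_invfVK f) (@sinfty_invfK f)) => n nN.
by rewrite -{1}(fN n nN) sinfty_invfK.
Qed.

Definition sinfty_one := MkSinfty sinfty_one_subproof.
Definition sinfty_mul f g := MkSinfty (sinfty_mul_subproof f g).
Definition sinfty_inv f := MkSinfty (sinfty_inv_subproof f).

Lemma sinfty_mulA : associative sinfty_mul.
Proof. by move=> f g h; apply: sinfty_eqP. Qed.
Lemma sinfty_mul1 : left_id sinfty_one sinfty_mul.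
Proof. by move=> f; apply: sinfty_eqP. Qed.
Lemma sinfty_mulr1 : right_id sinfty_one sinfty_mul.
Proof. by move=> f; apply: sinfty_eqP. Qed.
Lemma sinfty_mulV : left_inverse sinfty_one sinfty_inv sinfty_mul.
Proof. by move=> f; apply: sinfty_eqP => n; apply: sinfty_invfK. Qed.
Lemma sinfty_mulVr : right_inverse sinfty_one sinfty_inv sinfty_mul.
Proof. by move=> f; apply: sinfty_eqP => n; apply: sinfty_invfVK. Qed.

HB.instance Definition _ := isGroup.Build Sinfty
  sinfty_mulA sinfty_mul1 sinfty_mulr1 sinfty_mulV sinfty_mulVr.

Lemma sinftyM (f g : Sinfty) n : (f * g)%g n = f (g n). Proof. by []. Qed.
Lemma sinfty1 n : (1%g : Sinfty) n = n. Proof. by []. Qed.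

Definition G : groupType := (Sinfty * Sinfty * Sinfty)%type.

Definition diag (h : Sinfty) : G := (h, h, h).

Definition K (alpha : nat) : set G :=
  [set diag h | h in [set h : Sinfty | forall n, (n < alpha)%N -> h n = n]].

Definition dcoset (alpha beta : nat) (g : G) : set G :=
  [set (x * g * y)%g | x in K alpha & y in K beta].

Definition dcosets (alpha beta : nat) : set (set G) :=
  range (dcoset alpha beta).

Definition dclass (alpha beta : nat) (g : G) : dcosets alpha beta :=
  SigSub (mem_set (imageT (dcoset alpha beta) g)).

Definition dc_repr (alpha beta : nat) (p : dcosets alpha beta) : G :=
  xget 1%g (val p).

Lemma dclassP alpha beta (p : dcosets alpha beta) :
  exists g, p = dclass alpha beta g.
Proof.
by case: p => p /[dup] /set_mem [g _ <-] pP; exists g; apply: val_inj.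
Qed.

Lemma diagM h k : diag (h * k)%g = (diag h * diag k)%g. Proof. by []. Qed.
Lemma diagV h : diag h^-1%g = (diag h)^-1%g. Proof. by []. Qed.

Lemma K1 a : K a 1%g.
Proof. by exists 1%g. Qed.

Lemma KM a x y : K a x -> K a y -> K a (x * y)%g.
Proof.
move=> [h /= hP <-] [k /= kP <-]; exists (h * k)%g => //= n na.
by rewrite kP// hP.
Qed.

Lemma KV a x : K a x -> K a x^-1%g.
Proof.
move=> [h /= hP <-]; exists h^-1%g => //= n na.
have := sinfty_invfK h n; rewrite hP//.
Qed.

Lemma dclass_eq a b x g y : K a x -> K b y ->
  dclass a b (x * g * y)%g = dclass a b g.
Proof.
move=> Kx Ky; apply: val_inj; apply/seteqP; split => _ /= [u Ku [v Kv <-]].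
  exists (u * x)%g; first exact: KM.
  by exists (y * v)%g; [exact: KM|rewrite !mulgA].
exists (u * x^-1)%g; first exact/KM/KV.
exists (y^-1 * v)%g; first by apply: KM => //; exact: KV.
by rewrite !mulgA mulgVK mulgK.
Qed.

Lemma mem_dclass a b g : val (dclass a b g) g.
Proof.
by exists 1%g; [exact: K1|exists 1%g; [exact: K1|rewrite mul1g mulg1]].
Qed.

Lemma mem_dclassE a b g g' : val (dclass a b g) g' ->
  exists x y, [/\ K a x, K b y & g' = (x * g * y)%g].
Proof. by move=> [x Kx [y Ky <-]]; exists x, y. Qed.

Lemma dc_repr_mem a b (p : dcosets a b) : val p (dc_repr p).
Proof.
have [g ->] := dclassP p; rewrite /dc_repr.
by case: xgetP => // /(_ g) []; exact: mem_dclass.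
Qed.

Lemma dclass_mem a b (p : dcosets a b) g : val p g -> p = dclass a b g.
Proof.
have [g' ->] := dclassP p; move=> /mem_dclassE [x [y [Kx Ky ->]]].
by rewrite dclass_eq.
Qed.

Lemma dc_reprK a b (p : dcosets a b) : dclass a b (dc_repr p) = p.
Proof. exact/esym/dclass_mem/dc_repr_mem. Qed.

Definition theta_fun (j beta n : nat) : nat :=
  if (beta <= n < beta + j)%N then (n + j)%N
  else if (beta + j <= n < beta + j.*2)%N then (n - j)%N else n.

Lemma theta_funK j beta : involutive (theta_fun j beta).
Proof. by move=> n; rewrite /theta_fun; do ![case: ifP]; lia. Qed.

Lemma theta_subproof j beta : theta_fun j beta \in finitary_perm.
Proof.
apply: (@finitary_permP _ _ (beta + j.*2) (@theta_funK j beta)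
  (@theta_funK j beta)) => n; rewrite /theta_fun; do ![case: ifP]; lia.
Qed.

Definition theta (j beta : nat) : G := diag (MkSinfty (theta_subproof j beta)).

Lemma thetaV j b : (theta j b * theta j b)%g = 1%g.
Proof.
rewrite -diagM; congr diag; apply: sinfty_eqP => n.
exact: theta_funK.
Qed.

Definition supp_lt N (g : G) :=
  forall n, (N <= n)%N -> [/\ g.1.1 n = n, g.1.2 n = n & g.2 n = n].

Lemma supp_ltW N M g : (N <= M)%N -> supp_lt N g -> supp_lt M g.
Proof. by move=> NM gN n nM; apply: gN; exact: leq_trans nM. Qed.

Lemma supp_lt_ex g : exists N, supp_lt N g.
Proof.
have [N1 h1] := sinfty_bound g.1.1; have [N2 h2] := sinfty_bound g.1.2.
have [N3 h3] := sinfty_bound g.2; exists (maxn N1 (maxn N2 N3)) => n.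
by rewrite !geq_max => /and3P[n1 n2 n3]; rewrite h1 ?h2 ?h3.
Qed.

Lemma sinfty_commute N (f h : Sinfty) : (forall n, (N <= n)%N -> f n = n) ->
  (forall n, (n < N)%N -> h n = n) -> (f * h)%g = (h * f)%g.
Proof.
move=> fN hN; apply: sinfty_eqP => n; rewrite !sinftyM.
have [nN|Nn] := ltnP n N.
  rewrite hN// hN//; rewrite ltnNge; apply/negP => Nf.
  by have := bij_inj (sinfty_bij f) (fN _ Nf) => fE; move: Nf; rewrite fE leqNgt nN.
rewrite (fN n)// fN//; rewrite leqNgt; apply/negP => hn.
have := bij_inj (sinfty_bij h) (hN _ hn) => hE; move: hn; rewrite hE.
by rewrite ltnNge Nn.
Qed.

Lemma K_commute N g x : supp_lt N g -> K N x -> (g * x)%g = (x * g)%g.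
Proof.
case: g => -[g1 g2] g3 gN [h /= hN <-].
by congr (_, _, _); apply: (@sinfty_commute N) => // n /gN[].
Qed.

Lemma KW a b x : (a <= b)%N -> K b x -> K a x.
Proof.
move=> ab [h /= hb <-]; exists h => //= n na; apply: hb; exact: leq_trans na ab.
Qed.

Definition shift_fun (l m n : nat) :=
  if (l <= n < m)%N then n.+1 else if (n == m) && (l <= m)%N then l else n.

Definition unshift_fun (l m n : nat) :=
  if (l < n <= m)%N then n.-1 else if (n == l) && (l <= m)%N then m else n.

Lemma shift_funK l m : cancel (shift_fun l m) (unshift_fun l m).
Proof. by move=> n; rewrite /shift_fun /unshift_fun; do ![case: ifP]; lia. Qed.

Lemma unshift_funK l m : cancel (unshift_fun l m) (shift_fun l m).
Proof. by move=> n; rewrite /shift_fun /unshift_fun; do ![case: ifP]; lia. Qed.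

Lemma shift_subproof l m : shift_fun l m \in finitary_perm.
Proof.
apply: (@finitary_permP _ _ (maxn l m.+1) (@shift_funK l m) (@unshift_funK l m)).
by move=> n; rewrite /shift_fun; do ![case: ifP]; lia.
Qed.

Lemma theta_step N j b : (b <= N)%N -> (N <= j)%N ->
  exists x y, [/\ K N x, K N y & theta j.+1 b = (x * theta j b * y)%g].
Proof.
move=> bN Nj; pose s := MkSinfty (shift_subproof (b + j) (N + j)).
pose y := (diag s)^-1%g.
have Ks : K N (diag s).
  exists s => //= n nN; rewrite /shift_fun; do ![case: ifP]; lia.
exists (theta j.+1 b * diag s * theta j b)%g, y; split.
- rewrite -!diagM; eexists; last reflexivity.
  move=> n /= nN; rewrite /shift_fun /theta_fun; do ![case: ifP]; lia.
- exact: KV.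
- by rewrite -!mulgA (mulgA (theta j b) (theta j b)) thetaV mul1g mulgV mulg1.
Qed.

Lemma dclass_step N a b c j p q : supp_lt N p -> supp_lt N q ->
  (a <= N)%N -> (b <= N)%N -> (c <= N)%N -> (N <= j)%N ->
  dclass a c (p * theta j.+1 b * q)%g = dclass a c (p * theta j b * q)%g.
Proof.
move=> pN qN aN bN cN Nj.
have [x [y [Kx Ky ->]]] := theta_step bN Nj.
have -> : (p * (x * theta j b * y) * q = x * (p * theta j b * q) * y)%g.
  rewrite !mulgA (K_commute pN Kx) -!mulgA; do 3 congr (_ * _)%g.
  exact/esym/(K_commute qN Ky).
exact: dclass_eq (KW aN Kx) (KW cN Ky).
Qed.

Lemma theta_conj j b x : supp_lt (b + j) x -> K b x ->
  K (b + j) (theta j b * x * theta j b)%g.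
Proof.
move=> xj [h /= hb xE]; move: xj; rewrite -xE => hj.
rewrite -!diagM; eexists; last reflexivity.
move=> n /= nbj.
have -> : theta_fun j b n = if (b <= n)%N then (n + j)%N else n.
  by rewrite /theta_fun; do ![case: ifP]; lia.
case: leqP => bn.
  have [|-> _ _] := hj (n + j)%N; first by lia.
  by rewrite /theta_fun; do ![case: ifP]; lia.
by rewrite hb// /theta_fun; do ![case: ifP]; lia.
Qed.

(* The eventual value of the sequence K[a] p theta_j[b] q K[c]; [dc_compP] shows
   that it exists and does not depend on the representatives. *)
Definition dc_comp a b c (p : dcosets a b) (q : dcosets b c) : dcosets a c :=
  xget (dclass a c 1%g) [set r | \forall j \near \oo,
    r = dclass a c (dc_repr p * theta j b * dc_repr q)%g].

Lemma dclass_stable a b c p q : exists N, forall j, (N <= j)%N ->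
  dclass a c (p * theta j b * q)%g = dclass a c (p * theta N b * q)%g.
Proof.
have [N1 pN] := supp_lt_ex p; have [N2 qN] := supp_lt_ex q.
pose N := (N1 + N2 + a + b + c)%N; exists N; elim=> [|j IH].
  by rewrite leqn0 => /eqP ->.
rewrite leq_eqVlt => /predU1P[->|Nj]; first by [].
rewrite -IH; last by [].
apply: (@dclass_step N) => //; rewrite ?/N; try lia.
  by apply: supp_ltW pN; lia.
by apply: supp_ltW qN; lia.
Qed.

Lemma supp_ltM N g h : supp_lt N g -> supp_lt N h -> supp_lt N (g * h)%g.
Proof.
by move=> gN hN n nN; have [g1 g2 g3] := gN n nN; have [h1 h2 h3] := hN n nN;
  split; rewrite /= ?h1 ?h2 ?h3.
Qed.

Lemma dclass_indep a b c p q x y x' y' :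
  K a x -> K b y -> K b x' -> K c y' -> \forall j \near \oo,
  dclass a c ((x * p * y) * theta j b * (x' * q * y'))%g =
  dclass a c (p * theta j b * q)%g.
Proof.
move=> Kx Ky Kx' Ky'.
have [N1 pN] := supp_lt_ex p; have [N2 qN] := supp_lt_ex q.
have [N3 yN] := supp_lt_ex y; have [N4 xN] := supp_lt_ex x'.
pose N := (N1 + N2 + N3 + N4 + a + c)%N.
exists N => // j /= Nj.
have -> : ((x * p * y) * theta j b * (x' * q * y') =
  x * (p * y * theta j b * x' * q) * y')%g by rewrite !mulgA.
rewrite dclass_eq//.
pose u := (theta j b * y * theta j b)%g.
pose v := (theta j b * x' * theta j b)%g.
have Ku : K (b + j) u.
  by apply: theta_conj => //; apply: supp_ltW yN; rewrite /N in Nj; lia.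
have Kv : K (b + j) v.
  by apply: theta_conj => //; apply: supp_ltW xN; rewrite /N in Nj; lia.
have sq : supp_lt (b + j) (x' * q)%g.
  by apply: supp_ltM; [apply: supp_ltW xN|apply: supp_ltW qN];
    rewrite /N in Nj; lia.
have sp : supp_lt (b + j) p.
  by apply: supp_ltW pN; rewrite /N in Nj; lia.
have yE : (y * theta j b = theta j b * u)%g.
  by rewrite /u !mulgA thetaV mul1g.
have xE : (theta j b * x' = v * theta j b)%g.
  by rewrite /v -!mulgA thetaV mulg1.
clearbody u v.
have -> : (p * y * theta j b * x' * q = v * (p * theta j b * q) * u)%g.
  rewrite -(mulgA p) yE -!mulgA -(K_commute sq Ku) !mulgA.
  by rewrite -(mulgA p) xE mulgA (K_commute sp Kv).
by apply: dclass_eq; [apply: KW Kv|apply: KW Ku]; rewrite /N in Nj; lia.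
Qed.

Lemma dc_compP a b c (p : dcosets a b) (q : dcosets b c) g h :
  val p g -> val q h ->
  \forall j \near \oo, dclass a c (g * theta j b * h)%g = dc_comp p q.
Proof.
move=> pg qh; rewrite /dc_comp; case: xgetP => [r _ rE|]; last first.
  have [N rE] := dclass_stable a b c (dc_repr p) (dc_repr q).
  move=> /(_ (dclass a c (dc_repr p * theta N b * dc_repr q)%g)) [].
  by exists N => // j /= Nj; rewrite rE.
have := pg; rewrite {1}(dclass_mem (dc_repr_mem p)).
move=> /mem_dclassE [x [y [Kx Ky gE]]].
have := qh; rewrite {1}(dclass_mem (dc_repr_mem q)).
move=> /mem_dclassE [x' [y' [Kx' Ky' hE]]].
have := dclass_indep (dc_repr p) (dc_repr q) Kx Ky Kx' Ky'.
rewrite -gE -hE => H; near=> j.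
transitivity (dclass a c (dc_repr p * theta j b * dc_repr q)%g).
  by near: j.
by apply/esym; near: j.
Unshelve. all: by end_near. Qed.

(* [dc_invP]: any representative gives the same double coset. *)
Definition dc_inv a b (p : dcosets a b) : dcosets b a :=
  dclass b a (dc_repr p)^-1%g.

Lemma dc_invP a b (p : dcosets a b) g : val p g -> dc_inv p = dclass b a g^-1%g.
Proof.
rewrite {1}(dclass_mem (dc_repr_mem p)) => /mem_dclassE [x [y [Kx Ky ->]]].
by rewrite !invgM mulgA dclass_eq//; exact: KV.
Qed.

HB.mixin Record CompleteNormedModule_hasInner (R : realType) H
    of CompleteNormedModule R[i] H := {
  inner : H -> H -> R[i];
  inner_linear : forall (a : R[i]) (x y z : H),
    inner (a *: x + y) z = a * inner x z + inner y z;
  inner_conj : forall x y : H, inner y x = (inner x y)^*%C;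
  inner_norm : forall x : H, inner x x = `|x| ^+ 2 }.

#[short(type="hilbertType")]
HB.structure Definition Hilbert (R : realType) :=
  {H of CompleteNormedModule R[i] H & CompleteNormedModule_hasInner R H}.

(* The operators [rep g] are invertible, with inverse [rep g^-1]; preserving
   the inner product thus makes them unitary. *)
Record unitary_rep (Gamma : groupType) (R : realType) (H : hilbertType R) := {
  rep :> Gamma -> {linear H -> H};
  rep1 : forall x, rep 1%g x = x;
  repM : forall g h x, rep (g * h)%g x = rep g (rep h x);
  rep_inner : forall g x y, inner (rep g x) (rep g y) = inner x y }.

Section Fixed.
Variables (R : realType) (H : hilbertType R) (rho : unitary_rep G H).
Variable alpha : nat.

Definition fixed_pred : {pred H} :=
  fun x => `[< forall g, K alpha g -> rho g x = x >].

Record fixed := MkFixed { fixed_val :> H; fixedP : fixed_val \in fixed_pred }.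

HB.instance Definition _ := [isSub for fixed_val].
HB.instance Definition _ := [Choice of fixed by <:].

Lemma fixed_submod_closed : submod_closed fixed_pred.
Proof.
split=> [|a x y /asboolP fx /asboolP fy]; apply/asboolP => g Kg.
  exact: raddf0.
by rewrite linearP fx// fy.
Qed.

HB.instance Definition _ := GRing.isSubmodClosed.Build R[i] H fixed_pred
  fixed_submod_closed.
HB.instance Definition _ := [SubChoice_isSubLmodule of fixed by <:].

Definition fixed_norm (x : fixed) : R[i] := `|val x|.

Lemma fixed_normD x y : fixed_norm (x + y) <= fixed_norm x + fixed_norm y.
Proof. exact: ler_normD. Qed.

Lemma fixed_normZ (l : R[i]) x : fixed_norm (l *: x) = `|l| * fixed_norm x.
Proof. exact: normrZ. Qed.

Lemma fixed_norm0 x : fixed_norm x = 0 -> x = 0.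
Proof. by move=> /normr0_eq0 x0; apply: val_inj. Qed.

HB.instance Definition _ := Lmodule_isNormed.Build R[i] fixed
  fixed_normD fixed_normZ fixed_norm0.

Lemma rep_norm g x : `|rho g x| = `|x|.
Proof.
by apply/eqP; rewrite -(eqrXn2 (n := 2))// -!inner_norm rep_inner.
Qed.

Lemma fixed_complete (F : set_system fixed) : ProperFilter F -> cauchy F -> cvg F.
Proof.
move=> FF /cauchyP cF.
have : cauchy (val @ F).
  apply/cauchyP => e e0; have [x Fx] := cF e e0.
  exists (val x); rewrite /nbhs /=; apply: filterS Fx => y.
  by rewrite -!ball_normE.
move=> /cauchy_cvg; set l := lim _ => /cvgrPdist_lt Fl.
have lP : l \in fixed_pred.
  apply/asboolP => g Kg; apply/eqP; rewrite -subr_eq0 -normr_le0.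
  apply/ler_addgt0Pr => e e0; rewrite add0r.
  have [y] := @filter_ex _ _ FF _ (Fl _ (divr_gt0 e0 (ltr0Sn _ 1))).
  have /asboolP/(_ g Kg) gy := fixedP y => /= ly.
  have -> : rho g l - l = rho g (l - val y) - (l - val y).
    by rewrite linearB /= gy opprB addrA subrK.
  rewrite (le_trans (ler_normB _ _))// rep_norm (splitr e).
  by apply: lerD; exact: ltW.
apply: (@cvgP _ _ (MkFixed lP)); apply/cvgrPdist_lt => e e0.
exact: Fl.
Qed.

HB.instance Definition _ := Uniform_isComplete.Build fixed fixed_complete.

Definition fixed_inner (x y : fixed) : R[i] := inner (val x) (val y).
Lemma fixed_inner_linear (a : R[i]) (x y z : fixed) :
    fixed_inner (a *: x + y) z = a * fixed_inner x z + fixed_inner y z.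
Proof. exact: inner_linear. Qed.
Lemma fixed_inner_conj x y : fixed_inner y x = (fixed_inner x y)^*%C.
Proof. exact: inner_conj. Qed.
Lemma fixed_inner_norm x : fixed_inner x x = `|x| ^+ 2.
Proof. exact: inner_norm. Qed.
HB.instance Definition _ := CompleteNormedModule_hasInner.Build R fixed
  fixed_inner_linear fixed_inner_conj fixed_inner_norm.

(* [fixed] is a closed subspace, so that by the projection theorem exactly one
   point meets the condition and the default value 0 plays no role. *)
Definition fixed_proj (x : H) : fixed :=
  xget 0 [set y : fixed | forall z : fixed, inner (x - val y) (val z) = 0].

Lemma fixed_proj_rep g x : K alpha g -> fixed_proj (rho g x) = fixed_proj x.
Proof.
move=> Kg; congr (xget 0 _); apply/seteqP; split => y /= yP z; rewrite -(yP z).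
  have /asboolP/(_ g Kg) gy := fixedP y; have /asboolP/(_ g Kg) gz := fixedP z.
  by rewrite -(rep_inner rho g) linearB /= gy gz.
have /asboolP/(_ g Kg) gy := fixedP y; have /asboolP/(_ g Kg) gz := fixedP z.
by rewrite -[RHS](rep_inner rho g) linearB /= gy gz.
Qed.

End Fixed.

Arguments fixed_proj {R H} rho alpha x.

Section Operators.
Variables (R : realType) (U V : hilbertType R).

(* [`|A x|] is a nonnegative element of R[i]. The supremum is +oo when A is
   unbounded. *)
Definition opnorm (A : U -> V) : \bar R :=
  ereal_sup [set (complex.Re `|A x|)%:E | x in [set x : U | `|x| <= 1]].

(* For a bounded linear A, exactly one z meets the condition (Riesz). *)
Definition adjoint (A : U -> V) : V -> U :=
  fun y => xget 0 [set z : U | forall x, inner (A x) y = inner x z].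

End Operators.

Section Rhot.
Variables (R : realType) (H : hilbertType R) (rho : unitary_rep G H).

(* [rhotP]: any representative gives the same operator. *)
Definition rhot alpha beta (p : dcosets alpha beta) :
    fixed rho beta -> fixed rho alpha :=
  fun v => fixed_proj rho alpha (rho (dc_repr p) (val v)).

Lemma rhotP alpha beta (p : dcosets alpha beta) g : val p g ->
  rhot p = fun v => fixed_proj rho alpha (rho g (val v)).
Proof.
rewrite {1}(dclass_mem (dc_repr_mem p)) => /mem_dclassE [x [y [Kx Ky ->]]].
apply/funext => v; rewrite /rhot !repM (@fixed_proj_rep _ _ rho _ _ _ Kx).
by have /asboolP/(_ y Ky) /= -> := fixedP v.
Qed.

End Rhot.

Arguments rhot {R H} rho {alpha beta} p.

(* Main.v *)
Require Import Defs.
From mathcomp Require Import all_boot all_order all_algebra.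
From mathcomp Require Import all_classical all_reals all_analysis.
From mathcomp Require Import complex.
From mathcomp Require Import zify ring.

Set Implicit Arguments.
Unset Strict Implicit.
Unset Printing Implicit Defensive.

Import Order.TTheory GRing.Theory Num.Theory.
Import numFieldNormedType.Exports.

Local Open Scope classical_set_scope.
Local Open Scope ring_scope.

(** The operators multiply correctly because the projection P[b] onto the
    K[b]-fixed vectors is a weak limit of the operators rho(theta_j[b]), in the
    following strong sense.  Call x tame if it is fixed by some K[N].  Since an
    element g of G moves finitely many points, it commutes with K[N] for large
    N, so rho(g) x is tame whenever x is.  For x and z fixed by K[N], the number
    <rho(theta_j[b]) x, z> depends only on the double coset
    K[N] theta_j[b] K[N], hence not on j once j >= N.  The key fact
    [fixed_proj_theta] is that this number equals <P[b] x, z>.  Applied to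
    x = rho(q) v and to rho(p)^-1 w, where v and w are fixed by K[c] and K[a],
    it reads
      <rho(p) P[b] rho(q) v, w> = <rho(p theta_j[b] q) v, w>
    for large j, which is the multiplicativity ([rhot_comp]).

    For tame x the same argument constructs P[b] x ([exists_fixed_proj]).
    Along the indices j = 2^(N+m) the vectors w_m = rho(theta_j[b]) x all have
    the same norm, and any two of them have the same inner product c
    ([inner_theta_theta]).  Averages of such a sequence over longer and longer
    disjoint blocks form a Cauchy sequence ([block_mean_cvg]): the part common
    to all w_m survives, the rest is orthogonal and averages out.  The limit is
    fixed by each g in K[b], because theta_j[b] conjugates g into K[N] for large
    j, so that g fixes w_m for large m; its inner products with the vectors
    fixed by K[N] are the constants above.

    The formula for the adjoint and the bound on the norm then follow from
    <P[a] x, z> = <x, z> for z fixed by K[a], the unitarity of rho(p), and the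
    fact that an orthogonal projection is a contraction. *)

(** * Inner products *)

Section Inner.
Variables (R : realType) (H : hilbertType R).
Implicit Types (x y z : H) (a : R[i]).

Lemma innerDl x y z : inner (x + y) z = inner x z + inner y z.
Proof. by rewrite -{1}(scale1r x) inner_linear mul1r. Qed.

Lemma inner0l z : inner 0 z = 0.
Proof. by apply: (@addrI _ (inner 0 z)); rewrite -innerDl !addr0. Qed.

Lemma innerZl a x z : inner (a *: x) z = a * inner x z.
Proof. by rewrite -{1}(addr0 (a *: x)) inner_linear inner0l addr0. Qed.

Lemma innerBl x y z : inner (x - y) z = inner x z - inner y z.
Proof. by rewrite innerDl -scaleN1r innerZl mulN1r. Qed.

Lemma innerBr x y z : inner z (x - y) = inner z x - inner z y.
Proof. by rewrite inner_conj innerBl rmorphB /= -!inner_conj. Qed.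

Lemma innerZr a x z : inner z (a *: x) = a^*%C * inner z x.
Proof. by rewrite inner_conj innerZl rmorphM /= -inner_conj. Qed.

Lemma inner_suml (I : Type) (r : seq I) (F : I -> H) z :
  inner (\sum_(i <- r) F i) z = \sum_(i <- r) inner (F i) z.
Proof. by apply: (big_morph (inner^~ z)) => [x y|]; rewrite ?innerDl ?inner0l. Qed.

Lemma inner_ge0 x : 0 <= inner x x.
Proof. by rewrite inner_norm exprn_ge0. Qed.

Lemma inner_eq0 x : inner x x = 0 -> x = 0.
Proof. by rewrite inner_norm => /eqP; rewrite sqrf_eq0 normr_eq0 => /eqP. Qed.

(** Cauchy-Schwarz. *)
Lemma norm_inner_le x y : `|inner x y| <= `|x| * `|y|.
Proof.
have [->|y0] := eqVneq y 0.
  by rewrite inner_conj inner0l rmorph0 !normr0 mulr0.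
have ny0 : 0 < `|y| ^+ 2 by rewrite exprn_gt0// normr_gt0.
rewrite -ler_sqr ?nnegrE ?mulr_ge0// exprMn.
set a := inner x y.
have yy : inner y y = `|y| ^+ 2 by exact: inner_norm.
(* This vector is |y|^2 times the component of x orthogonal to y. *)
have := inner_ge0 ((`|y| ^+ 2) *: x - a *: y).
rewrite !(innerBl, innerBr, innerZl, innerZr) (inner_conj x y) -/a yy.
have -> : `|a| ^+ 2 = a * a^*%C by exact: sqr_normc.
set b := a^*%C; set n := `|y| ^+ 2.
have -> : n^*%C = n by rewrite /n -inner_norm -inner_conj.
rewrite [X in 0 <= X -> _](_ : _ = n * (`|x| ^+ 2 * n - a * b)); last first.
  by rewrite inner_norm; ring.
by rewrite pmulr_rge0// subr_ge0.
Qed.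

End Inner.

(** Inner products with a fixed vector are continuous; the form needed here is
    that of a constant sequence of inner products. *)
Lemma inner_cvg_eq (R : realType) (H : hilbertType R) (s : nat -> H) (y z : H) a :
  s n @[n --> \oo] --> y -> (forall n, inner (s n) z = a) -> inner y z = a.
Proof.
move=> /cvgrPdist_lt sy sz; apply/eqP; rewrite -subr_eq0 -normr_le0.
apply/ler_addgt0Pr => e e0; rewrite add0r.
have z1 : 0 < `|z| + 1 by rewrite ltr_wpDl.
have [n /= yn] := @filter_ex _ _ _ _ (sy _ (divr_gt0 e0 z1)).
rewrite -(sz n) -innerBl (le_trans (norm_inner_le _ _))//.
rewrite (le_trans (ler_wpM2l _ (_ : _ <= `|z| + 1)))// ?lerDl//.
by rewrite -ler_pdivlMr// ltW.
Qed.

(** * Block means of a sequence with constant Gram matrix off the diagonal *)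

(** The Archimedean property of R[i]: its nonnegative elements are real. *)
Lemma complex_lt_nat (R : realType) (u : R[i]) : 0 <= u -> exists n, u < n%:R.
Proof.
case: u => a b; rewrite lecE /= => /andP[/eqP -> a0].
exists (Num.bound a).
rewrite -(rmorph_nat (real_complex R)) -[X in X < _]/(a%:C%C) ltcR.
exact: archi_boundP.
Qed.

Section BlockMean.
Variables (R : realType) (H : hilbertType R) (x : nat -> H).

(** Means over the blocks [k, 2k) rather than over the initial segments [0, k):
    doubling k makes the blocks disjoint, and a mean over a late block only sees
    the tail of the sequence. *)
Definition block_mean k : H := k%:R^-1 *: \sum_(i < k) x (k + i).

Lemma inner_block_mean k z a : (0 < k)%N ->
  (forall i, (k <= i < 2 * k)%N -> inner (x i) z = a) ->
  inner (block_mean k) z = a.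
Proof.
move=> k0 xz; rewrite innerZl inner_suml (eq_bigr (fun=> a)) => [|i _].
  by rewrite sumr_const card_ord -[a *+ k]mulr_natl mulKf// pnatr_eq0 -lt0n.
by apply: xz; have := ltn_ord i; lia.
Qed.

Variables c d : R[i].
Hypothesis x_neq : forall i j, i != j -> inner (x i) (x j) = c.
Hypothesis x_eq : forall i, inner (x i) (x i) = c + d.

Lemma gram_conj : c^*%C = c.
Proof. by rewrite -(@x_neq 0 1)// -inner_conj !x_neq. Qed.

Lemma gram_ge0 : 0 <= d.
Proof.
have := inner_ge0 (x 0 - x 1).
rewrite innerBl !innerBr !x_eq !x_neq// [X in 0 <= X](_ : _ = d *+ 2); last first.
  by ring.
by rewrite pmulrn_lge0.
Qed.

Lemma inner_block_mean_lt k l : (0 < k)%N -> (2 * k <= l)%N ->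
  inner (block_mean k) (block_mean l) = c.
Proof.
move=> k0 kl; apply: inner_block_mean => // i ik.
rewrite inner_conj (@inner_block_mean _ _ c) ?gram_conj//; first lia.
by move=> j jl; apply: x_neq; lia.
Qed.

Lemma inner_block_mean_eq k : (0 < k)%N ->
  inner (block_mean k) (block_mean k) = c + d / k%:R.
Proof.
move=> k0; have k_neq0 : k%:R != 0 :> R[i] by rewrite pnatr_eq0 -lt0n.
have d_conj : d^*%C = d.
  by apply: (@addrI _ c); rewrite -{1}gram_conj -rmorphD -(x_eq 0) /= -inner_conj.
have conjE : (c + d / k%:R)^*%C = c + d / k%:R.
  by rewrite rmorphD rmorphM fmorphV rmorph_nat /= gram_conj d_conj.
apply: inner_block_mean => // i ik.
rewrite inner_conj -[RHS]conjE; congr (_^*%C).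
have ltk : (i - k < k)%N by lia.
rewrite innerZl inner_suml (bigD1 (Ordinal ltk))//= subnKC; last by lia.
rewrite x_eq (eq_bigr (fun=> c)) => [|j ji]; last first.
  by apply: x_neq; apply: contra ji => /eqP ji; apply/eqP/val_inj => /=; lia.
rewrite sumr_const cardC1 card_ord addrAC -mulrS prednK//.
by rewrite -[c *+ k]mulr_natl; field.
Qed.

(** If all x i had a common component of squared norm c, their remainders would
    be orthogonal with squared norm d, and the means of these over disjoint
    blocks of lengths k and l would be at squared distance d/k + d/l, which is
    at most 2d/k. *)
Lemma block_mean_dist k l : (0 < k)%N -> (2 * k <= l)%N ->
  `|block_mean k - block_mean l| ^+ 2 <= (d *+ 2) / k%:R.
Proof.
move=> k0 kl; have l0 : (0 < l)%N by lia.
rewrite -inner_norm innerBl !innerBr !inner_block_mean_eq//.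
rewrite (inner_conj (block_mean k)) inner_block_mean_lt// gram_conj.
rewrite [leLHS](_ : _ = d / k%:R + d / l%:R); last by ring.
rewrite mulr2n mulrDl lerD2l ler_wpM2l ?gram_ge0//.
by rewrite lef_pV2 ?posrE ?ltr0n// ler_nat; lia.
Qed.

Lemma block_mean_cvg : cvg (block_mean (2 ^ n) @[n --> \oo]).
Proof.
apply: cauchy_cvg; apply/cauchyP => e e0.
have e20 : 0 < e ^+ 2 by exact: exprn_gt0.
have d2 : 0 <= d *+ 2 by rewrite pmulrn_lge0// gram_ge0.
have [N dN] := complex_lt_nat (divr_ge0 d2 (ltW e20)).
exists (block_mean (2 ^ N)); exists N => // n /= Nn.
rewrite -ball_normE /=.
move: Nn; rewrite leq_eqVlt => /predU1P[<-|Nn]; first by rewrite subrr normr0.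
rewrite -ltr_sqr ?nnegrE ?(ltW e0)//.
apply: le_lt_trans (block_mean_dist _ _) _; rewrite ?expn_gt0//.
  by rewrite -expnS leq_exp2l.
rewrite ltr_pdivrMr ?ltr0n ?expn_gt0// mulrC -ltr_pdivrMr//.
by rewrite (lt_trans dN)// ltr_nat ltn_expl.
Qed.

End BlockMean.

(** * The action of the theta elements on tame vectors *)

Lemma K_theta j b : K b (theta j b).
Proof.
eexists; last reflexivity.
by move=> n /= nb; rewrite /theta_fun; do ![case: ifP]; lia.
Qed.

Lemma supp_lt_theta j b : supp_lt (b + j.*2) (theta j b).
Proof. by move=> n nb; split; rewrite /= /theta_fun; do ![case: ifP]; lia. Qed.

Section Tame.
Variables (R : realType) (H : hilbertType R) (rho : unitary_rep G H).
Implicit Types (x y z : H) (g : G).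

Lemma fixed_predP a x :
  x \in fixed_pred rho a <-> forall g, K a g -> rho g x = x.
Proof. by split=> [/asboolP|?]; last exact/asboolP. Qed.

Lemma fixed_predW a b x :
  (a <= b)%N -> x \in fixed_pred rho a -> x \in fixed_pred rho b.
Proof. by move=> ab /fixed_predP xa; apply/fixed_predP => g /(KW ab)/xa. Qed.

(** Elements moving only points below N commute with K[N]. *)
Lemma rep_fixed_pred N g x : supp_lt N g ->
  x \in fixed_pred rho N -> rho g x \in fixed_pred rho N.
Proof.
move=> gN /fixed_predP xN; apply/fixed_predP => h Kh.
by rewrite -repM -(K_commute gN Kh) repM xN.
Qed.

Lemma inner_rep_adj g x y : inner (rho g x) y = inner x (rho g^-1%g y).
Proof. by rewrite -(rep_inner rho g^-1%g) -repM mulVg rep1. Qed.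

(** Matrix coefficients between K[N]-fixed vectors are functions on the double
    cosets of K[N]. *)
Lemma rep_inner_K N g x z : x \in fixed_pred rho N -> z \in fixed_pred rho N ->
  forall u v, K N u -> K N v ->
  inner (rho (u * g * v)%g x) z = inner (rho g x) z.
Proof.
move=> /fixed_predP xN /fixed_predP zN u v Ku Kv.
by rewrite !repM xN// inner_rep_adj zN//; exact: KV.
Qed.

Lemma inner_theta_const N b j x z : (b <= N)%N -> (N <= j)%N ->
  x \in fixed_pred rho N -> z \in fixed_pred rho N ->
  inner (rho (theta j b) x) z = inner (rho (theta N b) x) z.
Proof.
move=> bN + xN zN; elim: j => [|j IH]; first by rewrite leqn0 => /eqP ->.
rewrite leq_eqVlt => /predU1P[->//|Nj]; rewrite -IH//.
have [u [v [Ku Kv ->]]] := theta_step bN Nj.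
exact: rep_inner_K Ku Kv.
Qed.

Lemma theta_inv j b : ((theta j b)^-1 = theta j b)%g.
Proof. by apply: (mulgI (theta j b)); rewrite mulgV thetaV. Qed.

(** When 2j <= k, all the points moved by theta_j[b] are sent by theta_k[b] into
    [b + k, b + 2k), so theta_k[b] theta_j[b] = u theta_k[b] with u in K[N]:
    the product is again in the double coset of theta_N[b]. *)
Lemma inner_theta_theta N b j k x : (b <= N)%N -> (N <= j)%N -> (2 * j <= k)%N ->
  x \in fixed_pred rho N ->
  inner (rho (theta j b) x) (rho (theta k b) x) = inner (rho (theta N b) x) x.
Proof.
move=> bN Nj jk xN.
have Ku : K N (theta k b * theta j b * theta k b)%g.
  apply: (@KW _ (b + k)); first lia.
  apply: theta_conj; last exact: K_theta.
  by apply: supp_ltW (@supp_lt_theta j b); lia.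
have Nk : (N <= k)%N by lia.
rewrite -(inner_theta_const bN Nk xN xN) -(rep_inner_K _ xN xN Ku (K1 N)).
rewrite mulg1 -(mulgA _ _ (theta k b)) thetaV mulg1 repM.
by rewrite [RHS]inner_rep_adj theta_inv.
Qed.

(** For large j, theta_j[b] moves the support of g beyond N, that is, it conjugates
    g into K[N]. *)
Lemma rep_theta_fixed N b j g x : (N <= b + j)%N -> x \in fixed_pred rho N ->
  K b g -> supp_lt (b + j) g -> rho g (rho (theta j b) x) = rho (theta j b) x.
Proof.
move=> Nj /fixed_predP xN Kg gj; rewrite -repM.
have -> : (g * theta j b = theta j b * (theta j b * g * theta j b))%g.
  by rewrite !mulgA thetaV mul1g.
by rewrite repM xN//; apply: KW Nj _; exact: theta_conj.
Qed.

(** The vector y is the projection of x onto the K[b]-fixed vectors: when z is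
    itself fixed by K[b], the right-hand side is <x, z>.  The formula for all z
    fixed by K[N] is what links this projection to the product of double
    cosets. *)
Lemma exists_fixed_proj N b x : (b <= N)%N -> x \in fixed_pred rho N ->
  exists2 y, y \in fixed_pred rho b &
    forall z, z \in fixed_pred rho N ->
      inner y z = inner (rho (theta N b) x) z.
Proof.
move=> bN xN.
(* Powers of 2 make any two indices satisfy 2j <= k, and the shift by N makes
   all of them at least N. *)
pose j m := (2 ^ (N + m))%N.
have Nj m : (N + m <= j m)%N by rewrite ltnW// ltn_expl.
pose w m := rho (theta (j m) b) x.
have jS m n : (m < n)%N -> (2 * j m <= j n)%N.
  by move=> mn; rewrite -expnS leq_exp2l//; lia.
pose c := inner (rho (theta N b) x) x.
have wlt m n : (m < n)%N -> inner (w m) (w n) = c.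
  move=> /jS mn; apply: inner_theta_theta => //.
  exact: leq_trans (leq_addr _ _) (Nj m).
have cC : c^*%C = c.
  by rewrite /c -inner_conj [RHS]inner_rep_adj theta_inv.
have wneq m n : m != n -> inner (w m) (w n) = c.
  rewrite neq_ltn => /orP[/wlt //|nm].
  by rewrite inner_conj wlt.
have weq m : inner (w m) (w m) = c + (inner x x - c).
  by rewrite rep_inner addrC subrK.
have cvg_w := block_mean_cvg wneq weq.
exists (lim (block_mean w (2 ^ n) @[n --> \oo])).
  apply/fixed_predP => g Kg.
  have [M gM] := supp_lt_ex g.
  have gw i : (M <= i)%N -> rho g (w i) = w i.
    move=> Mi; have ij := Nj i.
    apply: (@rep_theta_fixed N) => //; first lia.
    by apply: supp_ltW gM; lia.
  have gs n : (M <= n)%N ->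
      rho g (block_mean w (2 ^ n)) = block_mean w (2 ^ n).
    move=> Mn; rewrite linearZ linear_sum /=; congr (_ *: _).
    apply: eq_bigr => i _; apply: gw.
    by have := ltn_expl n (ltnSn 1); lia.
  set y := lim _ in cvg_w *.
  have gsy : rho g (block_mean w (2 ^ n)) @[n --> \oo] --> rho g y.
    apply/cvgrPdist_lt => e e0; move/cvgrPdist_lt: cvg_w => /(_ e e0) [m _ ym].
    by exists m => // n /ym /=; rewrite -linearB rep_norm.
  apply: (cvg_unique _ gsy) => //; apply: cvg_trans cvg_w.
  by apply: near_eq_cvg; exists M => // n /= /gs.
move=> z zN; apply: inner_cvg_eq cvg_w _ => n.
apply: inner_block_mean => [|i _]; first by rewrite expn_gt0.
apply: inner_theta_const => //; exact: leq_trans (leq_addr _ _) (Nj i).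
Qed.

End Tame.

(** * Projections of tame vectors and the operators of double cosets *)

Section FixedProj.
Variables (R : realType) (H : hilbertType R) (rho : unitary_rep G H).
Implicit Types (x z : H) (g : G).

(** P[b] is the eventual value of theta_j[b] between vectors fixed by K[N]. *)
Lemma fixed_proj_theta N b x z : (b <= N)%N -> x \in fixed_pred rho N ->
  z \in fixed_pred rho N ->
  inner (val (fixed_proj rho b x)) z = inner (rho (theta N b) x) z.
Proof.
move=> bN xN zN; have [y yb yE] := exists_fixed_proj bN xN.
suff -> : fixed_proj rho b x = MkFixed yb by exact: yE.
have theta_fix (u : fixed rho b) : rho (theta N b) (val u) = val u.
  by have /fixed_predP -> := fixedP u; last exact: K_theta.
have yP (u : fixed rho b) : inner (x - y) (val u) = 0.
  rewrite innerBl yE; last exact: fixed_predW bN (fixedP u).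
  by rewrite inner_rep_adj theta_inv theta_fix subrr.
apply: xget_unique => // y' y'P; apply: val_inj; apply/subr0_eq/inner_eq0.
have -> : val y' - y = val (y' - MkFixed yb) by [].
set u := y' - _; rewrite {1}(_ : val u = (x - y) - (x - val y')).
  by rewrite innerBl yP y'P subrr.
by rewrite opprB addrC addrA subrK.
Qed.

Lemma inner_fixed_proj N b x (z : fixed rho b) : x \in fixed_pred rho N ->
  inner (val (fixed_proj rho b x)) (val z) = inner x (val z).
Proof.
move=> xN; have bM := leq_addl N b.
rewrite (fixed_proj_theta bM).
- have /fixed_predP zb := fixedP z.
  by rewrite inner_rep_adj theta_inv zb//; exact: K_theta.
- by apply: fixed_predW xN; exact: leq_addr.
- exact: fixed_predW bM (fixedP z).
Qed.

(** The condition that singles out the projection of x involves x only through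
    its inner products with the fixed vectors. *)
Lemma eq_fixed_proj b x x' :
  (forall z : fixed rho b, inner x (val z) = inner x' (val z)) ->
  fixed_proj rho b x = fixed_proj rho b x'.
Proof.
move=> xx'; congr (xget 0 _); apply/seteqP; split => y /= yP z;
  by rewrite -(yP z) !innerBl xx'.
Qed.

Lemma norm_fixed_proj N b x : x \in fixed_pred rho N ->
  `|val (fixed_proj rho b x)| <= `|x|.
Proof.
move=> xN; rewrite -ler_sqr ?nnegrE// -!inner_norm.
set y := fixed_proj rho b x.
have xy : inner x (val y) = inner (val y) (val y).
  by rewrite -(inner_fixed_proj y xN).
have := inner_ge0 (x - val y); rewrite innerBl !innerBr.
by rewrite xy (inner_conj x (val y)) xy -inner_conj subrr subr0 subr_ge0.
Qed.

Lemma rep_fixed_tame a g (v : fixed rho a) :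
  exists N, rho g (val v) \in fixed_pred rho N.
Proof.
have [N gN] := supp_lt_ex g; exists (N + a)%N; apply: rep_fixed_pred.
  by apply: supp_ltW gN; exact: leq_addr.
by apply: fixed_predW (fixedP v); exact: leq_addl.
Qed.

Lemma inner_rhot a b (p : dcosets a b) g (v : fixed rho b) (w : fixed rho a) :
  val p g -> inner (rhot rho p v) w = inner (rho g (val v)) (val w).
Proof.
move=> pg; rewrite (rhotP rho pg).
by have [N xN] := rep_fixed_tame g v; exact: inner_fixed_proj xN.
Qed.

Lemma rhot_comp a b c (p : dcosets a b) (q : dcosets b c) :
  rhot rho p \o rhot rho q = rhot rho (dc_comp p q).
Proof.
apply/funext => v; pose g := dc_repr p; pose h := dc_repr q.
have [N1 gN] := supp_lt_ex g^-1%g.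
have [N2 _ pqE] := dc_compP (dc_repr_mem p) (dc_repr_mem q).
have [N3 hv] := rep_fixed_tame h v.
(* N makes the product of cosets stationary, and K[N] fixes both vectors between
   which theta_N[b] is evaluated: rho h v and rho g^-1 z. *)
pose N := (N1 + N2 + N3 + a + b)%N.
have pqN : val (dc_comp p q) (g * theta N b * h)%g.
  by rewrite -(pqE N) /=; [exact: mem_dclass|rewrite /N; lia].
rewrite (rhotP rho pqN) /= {1}/rhot; apply: eq_fixed_proj => z.
rewrite !repM -/g !(inner_rep_adj _ g); apply: fixed_proj_theta.
- by rewrite /N; lia.
- by apply: fixed_predW hv; rewrite /N; lia.
- apply: rep_fixed_pred; first by apply: supp_ltW gN; rewrite /N; lia.
  by apply: fixed_predW (fixedP z); rewrite /N; lia.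
Qed.

Lemma rhot_inv a b (p : dcosets a b) :
  rhot rho (dc_inv p) = adjoint (rhot rho p).
Proof.
have pp := dc_repr_mem p.
have ppV : val (dc_inv p) (dc_repr p)^-1%g.
  by rewrite (dc_invP pp); exact: mem_dclass.
apply/funext => w; apply/esym/xget_unique => [v|u uP].
  rewrite (inner_rhot _ _ pp) [RHS]inner_conj (inner_rhot _ _ ppV) -inner_conj.
  by rewrite inner_rep_adj.
apply/subr0_eq/inner_eq0; rewrite innerBr -uP (inner_rhot _ _ pp).
rewrite [X in _ - X]inner_conj (inner_rhot _ _ ppV) -inner_conj.
by rewrite inner_rep_adj subrr.
Qed.

Lemma opnorm_rhot a b (p : dcosets a b) : (opnorm (rhot rho p) <= 1)%E.
Proof.
apply: ge_ereal_sup => _ [v /= v1 <-]; rewrite lee_fin.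
have [N xN] := rep_fixed_tame (dc_repr p) v.
have := le_trans (norm_fixed_proj a xN) (_ : _ <= 1).
by rewrite rep_norm => /(_ v1); rewrite lecE => /andP[].
Qed.

End FixedProj.

Theorem theorem3p7 (R : realType) (H : hilbertType R) (rho : unitary_rep G H) :
  (forall (alpha beta gamma : nat)
          (p : dcosets alpha beta) (q : dcosets beta gamma),
     rhot rho p \o rhot rho q = rhot rho (dc_comp p q)) /\
  (forall (alpha beta : nat) (p : dcosets alpha beta),
     rhot rho (dc_inv p) = adjoint (rhot rho p) /\
     (opnorm (rhot rho p) <= 1)%E).
Proof.
split=> [alpha beta gamma p q|alpha beta p]; first exact: rhot_comp.
by split; [exact: rhot_inv|exact: opnorm_rhot].
Qed.
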